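(* Let $\hat\sigma$ be an isotropic Cauchy stress response with a unique stress-free reference configuration, i.e. $\hat\sigma(B)=0$ if and only if $B=\mathbb{1}$. Let $F\in\mathrm{GL}^+(3)$ be a deformation gradient which induces a Cauchy pure shear stress, i.e. $\hat\sigma(FF^T)=s\,(e_1\otimes e_2+e_2\otimes e_1)$ for some $s\in\mathbb{R}$. Then $F$ is necessarily of the form $$F=\begin{pmatrix}1&\gamma&0\\0&1&0\\0&0&1\end{pmatrix}\begin{pmatrix}a&0&0\\0&b&0\\0&0&c\end{pmatrix}Q$$ for some $Q\in\mathrm{SO}(3)$, where, for a suitable labelling $\lambda_1,\lambda_2,\lambda_3>0$ of the singular values of $F$, $$a=\lambda_1\lambda_2\sqrt{\frac{2}{\lambda_1^2+\lambda_2^2}},\qquad b=\sqrt{\frac{\lambda_1^2+\lambda_2^2}{2}},\qquad c=\lambda_3,\qquad \gamma=\frac{\lambda_1^2-\lambda_2^2}{\lambda_1^2+\lambda_2^2}.$$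
   Context: $\mathrm{GL}^+(3)$ denotes the real $3\times3$ matrices with positive determinant, $\mathrm{Sym}(3)$ the symmetric real $3\times 3$ matrices, $\mathrm{Sym}^+(3)$ the positive definite symmetric ones, and $\mathbb{1}$ the identity matrix. An isotropic Cauchy stress response is a map $\hat\sigma:\mathrm{Sym}^+(3)\to\mathrm{Sym}(3)$ with $\hat\sigma(QBQ^T)=Q\hat\sigma(B)Q^T$ for all $Q\in\mathrm{SO}(3)$ and $B\in\mathrm{Sym}^+(3)$; the Cauchy stress induced by a deformation gradient $F\in\mathrm{GL}^+(3)$ is $\hat\sigma(FF^T)$. The matrix $s\,(e_1\otimes e_2+e_2\otimes e_1)=\begin{pmatrix}0&s&0\\ s&0&0\\ 0&0&0\end{pmatrix}$ is called a pure shear stress. *)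

(* Defs.v *)
From mathcomp Require Import all_boot all_order all_algebra.
From mathcomp Require Import reals.

Set Implicit Arguments.
Unset Strict Implicit.
Unset Printing Implicit Defensive.

Import Order.TTheory GRing.Theory Num.Theory.
Local Open Scope ring_scope.

Definition pos_def_sym (R : realType) (n : nat) (B : 'M[R]_n) : Prop :=
  B \is symmetricmx /\
  forall x : 'cV[R]_n, x != 0 -> 0 < (x^T *m B *m x) 0 0.

Definition special_orthogonal (R : realType) (n : nat) (Q : 'M[R]_n) : Prop :=
  Q *m Q^T = 1%:M /\ \det Q = 1.

(* A response Sym+(3) -> Sym(3) is encoded as a function on all matrices about
   which nothing is assumed outside Sym+(3). *)
Definition isotropic_stress_response (R : realType)
    (sigma : 'M[R]_3 -> 'M[R]_3) : Prop :=
  (forall B, pos_def_sym B -> sigma B \is symmetricmx) /\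
  (forall Q B, special_orthogonal Q -> pos_def_sym B ->
     sigma (Q *m B *m Q^T) = Q *m sigma B *m Q^T).

Definition unique_stress_free_reference (R : realType)
    (sigma : 'M[R]_3 -> 'M[R]_3) : Prop :=
  forall B, pos_def_sym B -> (sigma B = 0 <-> B = 1%:M).

(* Indices start at 0, so e_1 (x) e_2 is delta_mx 0 1. *)
Definition pure_shear_stress (R : realType) (s : R) : 'M[R]_3 :=
  s *: (delta_mx 0 1 + delta_mx 1 0).

Definition simple_shear (R : realType) (g : R) : 'M[R]_3 :=
  1%:M + g *: delta_mx 0 1.

Definition diag3 (R : realType) (a b c : R) : 'M[R]_3 :=
  diag_mx (\row_(i < 3) [:: a; b; c]`_i).

(* s lists, with multiplicity and in some order, the nonnegative square roots
   of the eigenvalues of F^T F. *)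
Definition singular_values (R : realType) (n : nat) (F : 'M[R]_n)
    (s : seq R) : Prop :=
  all (fun x => 0 <= x) s /\
  char_poly (F^T *m F) = \prod_(x <- s) ('X - (x ^+ 2)%:P).

(* Main.v *)
(**
Let [B = F F^T].  An eigenvector [u] of [B] is also an eigenvector of
[sigma B]: the half turn about [u] commutes with [B], hence by isotropy with
[sigma B].  When [s <> 0] the pure shear stress has the simple eigenvalues
[s, -s, 0], so every eigenvector of [B] lies on one of the lines spanned by
[e_1 + e_2], [e_1 - e_2], [e_3].  If [B] were not diagonal in this basis, an
invariant plane orthogonal to one of these lines would contain an eigenvector
off all three.  Hence [B] is [p, q; q, p] on the first two coordinates and [r]
on the third (when [s = 0], [B = 1] has this form too), its eigenvalues are
[l1^2 = p + q], [l2^2 = p - q], [l3^2 = r], and the matrix [V] of the triangular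
factorisation satisfies [V V^T = B], so [Q = V^-1 F] is a rotation.
*)
Require Import Defs.
From mathcomp Require Import all_boot all_order all_algebra.
From mathcomp Require Import reals.
From mathcomp Require Import polyrcf ring lra.

Import Order.TTheory GRing.Theory Num.Theory.
Local Open Scope ring_scope.

Set Implicit Arguments.
Unset Strict Implicit.

(** * Coordinates in dimension three and algebraic preliminaries *)

Lemma ord3P (i : 'I_3) : [\/ i = 0, i = 1 | i = 2%:R].
Proof.
by case: i => [[|[|[|//]]] lti]; [constructor 1|constructor 2|constructor 3];
  apply/val_inj.
Qed.

Lemma sum_ord3 (V : nmodType) (f : 'I_3 -> V) :
  \sum_i f i = f 0 + f 1 + f 2%:R.
Proof.
rewrite !big_ord_recl big_ord0 addr0 addrA.
by congr (f _ + f _ + f _); apply/val_inj.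
Qed.

Lemma matrix3P (T : Type) (A B : 'M[T]_3) :
  A 0 0 = B 0 0 -> A 0 1 = B 0 1 -> A 0 2%:R = B 0 2%:R ->
  A 1 0 = B 1 0 -> A 1 1 = B 1 1 -> A 1 2%:R = B 1 2%:R ->
  A 2%:R 0 = B 2%:R 0 -> A 2%:R 1 = B 2%:R 1 -> A 2%:R 2%:R = B 2%:R 2%:R ->
  A = B.
Proof.
move=> *; apply/matrixP => i j.
by case: (ord3P i) => ->; case: (ord3P j) => ->.
Qed.

Lemma row3P (T : Type) (u v : 'rV[T]_3) :
  u 0 0 = v 0 0 -> u 0 1 = v 0 1 -> u 0 2%:R = v 0 2%:R -> u = v.
Proof.
by move=> *; apply/rowP => i; case: (ord3P i) => ->.
Qed.

Lemma det_mx33 (R : comNzRingType) (A : 'M[R]_3) :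
  \det A = A 0 0 * (A 1 1 * A 2%:R 2%:R - A 1 2%:R * A 2%:R 1)
         - A 0 1 * (A 1 0 * A 2%:R 2%:R - A 1 2%:R * A 2%:R 0)
         + A 0 2%:R * (A 1 0 * A 2%:R 1 - A 1 1 * A 2%:R 0).
Proof.
(* Indexing by natural numbers makes the ordinals produced by the minors reduce to identical terms
   before [ring]. *)
pose a i j := A (inord i) (inord j).
have aE i j : A i j = a i j by rewrite /a !inord_val.
rewrite (expand_det_row _ 0) sum_ord3 /cofactor.
do 3! rewrite (expand_det_row _ 0) !big_ord_recl big_ord0 /cofactor !det_mx11.
by rewrite !mxE !aE /= /bump /= !modn_small //=; ring.
Qed.

Lemma symmetricmxP (R : fieldType) (n : nat) (A : 'M[R]_n) :
  reflect (A^T = A) (A \is symmetricmx).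
Proof.
rewrite is_hermitianmxE expr0 scale1r map_mx_id //.
by apply: (iffP eqP) => [{2}->|->].
Qed.

(** The discriminant is a sum of nonnegative terms, and the value at 0 is [- k * b], which is
    nonzero. The root serves as the slope of an eigenvector off the shear axes. *)
Lemma quadratic_neq0_root (R : rcfType) (b d k : R) : b != 0 -> 0 < k ->
  exists2 w, w != 0 & b * w ^+ 2 + d * w - k * b = 0.
Proof.
move=> b0 k0; pose D := d ^+ 2 + 4 * k * b ^+ 2.
have D0 : 0 <= D.
  apply: addr_ge0; first exact: sqr_ge0.
  by rewrite mulr_ge0 ?sqr_ge0// mulr_ge0// ltW.
have sD := sqr_sqrtr D0; set r := Num.sqrt D in sD.
have wE : b * ((r - d) / (2 * b)) ^+ 2 + d * ((r - d) / (2 * b)) - k * b = 0.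
  transitivity ((r ^+ 2 - D) / (4 * b)); first by rewrite /D; field.
  by rewrite sD subrr mul0r.
exists ((r - d) / (2 * b)) => //; apply: contraTneq isT => w0.
move: wE; rewrite w0 => /eqP.
by rewrite expr0n/= !mulr0 !add0r oppr_eq0 mulf_eq0 (negPf b0) (gt_eqF k0).
Qed.

Lemma row_sqnorm_gt0 (R : realType) (n : nat) (u : 'rV[R]_n) :
  u != 0 -> 0 < (u *m u^T) 0 0.
Proof.
move=> u0; rewrite mxE.
have ge0 j : true -> 0 <= u 0 j * u^T j 0 by rewrite mxE -expr2 sqr_ge0.
rewrite lt0r sumr_ge0// andbT psumr_eq0//.
apply: contraNN u0 => /allP u0; apply/eqP/rowP => j.
by apply/eqP; have := u0 j (mem_index_enum _); rewrite !mxE -expr2 sqrf_eq0.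
Qed.

Lemma pos_def_mulmx_tr (R : realType) (n : nat) (F : 'M[R]_n) :
  F \in unitmx -> pos_def_sym (F *m F^T).
Proof.
move=> uF; split; first by apply/symmetricmxP; rewrite trmx_mul trmxK.
move=> x x0.
have -> : x^T *m (F *m F^T) *m x = (x^T *m F) *m (x^T *m F)^T.
  by rewrite trmx_mul trmxK !mulmxA.
apply: row_sqnorm_gt0; apply: contraNneq x0 => xF0.
by rewrite -(trmxK x) -[x^T](mulmxK uF) xF0 mul0mx trmx0.
Qed.

(** Both sides agree after multiplication by [\det P], since [P ('X - A) = ('X - B) P]. *)
Lemma char_poly_conjugate (R : fieldType) (n : nat) (P A B : 'M[R]_n) :
  P \in unitmx -> P *m A = B *m P -> char_poly A = char_poly B.
Proof.
move=> uP PA; have detP : \det (map_mx polyC P) != 0.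
  by rewrite det_map_mx polyC_eq0 -unitfE -unitmxE.
apply: (mulfI detP); rewrite /char_poly [RHS]mulrC -!det_mulmx.
congr (\det _); rewrite /char_poly_mx mulmxBr mulmxBl.
by rewrite -!map_mxM PA scalar_mxC.
Qed.

(** * Half turns, and the eigenvectors shared by [B] and its stress *)

(** Twice the orthogonal projection onto the line of [u], minus the identity; [u] is a row, so
    [u^T *m u] is the outer product. *)
Definition half_turn (R : realType) (u : 'rV[R]_3) : 'M[R]_3 :=
  (2 / (u *m u^T) 0 0) *: (u^T *m u) - 1%:M.

Lemma half_turn_special (R : realType) (u : 'rV[R]_3) :
  u != 0 -> special_orthogonal (half_turn u).
Proof.
move=> u0; rewrite /half_turn; set N := (u *m u^T) 0 0.
have N0 : N != 0 by rewrite gt_eqF// row_sqnorm_gt0.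
have NE : N = u 0 0 ^+ 2 + u 0 1 ^+ 2 + u 0 2%:R ^+ 2.
  by rewrite /N mxE sum_ord3 !mxE -!expr2.
split.
  rewrite linearB linearZ/= trmx_mul trmxK trmx1.
  have uu : u^T *m u *m (u^T *m u) = N *: (u^T *m u).
    rewrite mulmxA -(mulmxA u^T) [u *m u^T]mx11_scalar -/N.
    by rewrite mul_mx_scalar -scalemxAl.
  set Y := (2 / N) *: (u^T *m u).
  (* [Y] is twice a projection, so the symmetric matrix [Y - 1] squares to the identity. *)
  have YY : Y *m Y = Y + Y.
    rewrite -scalemxAl -scalemxAr uu !scalerA -scalerDl.
    by congr (_ *: _); field.
  by rewrite mulmxBl mul1mx mulmxBr mulmx1 YY addrK subKr.
rewrite det_mx33 !mxE !big_ord1 !mxE /=.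
rewrite !mulr1n !mulr0n !subr0 -/N.
by move: N0; rewrite NE => N0; field.
Qed.

Lemma mul_half_turn_eigen (R : realType) (u : 'rV[R]_3) (A : 'M[R]_3) (t : R) :
  A^T = A -> u *m A = t *: u -> half_turn u *m A = A *m half_turn u.
Proof.
move=> AT uA; have Au : A *m u^T = t *: u^T by rewrite -AT -trmx_mul uA linearZ.
rewrite /half_turn mulmxBl mulmxBr mul1mx mulmx1 -scalemxAl -scalemxAr.
by rewrite mulmxA Au -mulmxA uA -scalemxAl -scalemxAr.
Qed.

(** Commuting with the half turn amounts to commuting with [u^T *m u]; multiplying that relation by
    [u] on the left turns [N *: (u *m A)] into a multiple of [u]. *)
Lemma commute_half_turn_eigen (R : realType) (u : 'rV[R]_3) (A : 'M[R]_3) :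
  u != 0 -> half_turn u *m A = A *m half_turn u -> exists m, u *m A = m *: u.
Proof.
move=> u0; rewrite /half_turn; set N := (u *m u^T) 0 0.
have N0 : N != 0 by rewrite gt_eqF// row_sqnorm_gt0.
rewrite mulmxBl mulmxBr mul1mx mulmx1 -scalemxAl -scalemxAr.
have c0 : 2 / N != 0 by rewrite mulf_neq0 ?invr_neq0 ?pnatr_eq0.
move=> /addIr /(scalerI c0) QA.
exists (N^-1 * (u *m A *m u^T) 0 0).
have := congr1 (mulmx u) QA.
rewrite !mulmxA [u *m u^T]mx11_scalar -/N mul_scalar_mx -scalemxAl => NA.
rewrite -scalerA -(mul_scalar_mx (_ 0 0)) -mx11_scalar -NA scalerA mulVf//.
by rewrite scale1r.
Qed.

Lemma eigen_stress (R : realType) (sigma : 'M[R]_3 -> 'M[R]_3)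
    (B : 'M[R]_3) (u : 'rV[R]_3) (t : R) :
  isotropic_stress_response sigma -> pos_def_sym B -> u != 0 ->
  u *m B = t *: u -> exists m, u *m sigma B = m *: u.
Proof.
move=> [_ iso] pB u0 uB; have sQ := half_turn_special u0.
have BT : B^T = B by apply/symmetricmxP; case: pB.
apply: commute_half_turn_eigen => //; have := iso _ _ sQ pB.
have QQ : (half_turn u)^T *m half_turn u = 1%:M.
  by apply: mulmx1C; case: sQ.
rewrite (mul_half_turn_eigen BT uB) -mulmxA; case: (sQ) => -> _.
by rewrite mulmx1 => {2}->; rewrite -mulmxA QQ mulmx1.
Qed.

(* [u] is on the line of [e_3], [e_1 + e_2] or [e_1 - e_2], the eigenlines of a
   nonzero pure shear stress. *)
Definition shear_axis (R : realType) (u : 'rV[R]_3) : Prop :=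
  (u 0 0 = 0 /\ u 0 1 = 0) \/ (u 0 2%:R = 0 /\ u 0 0 ^+ 2 = u 0 1 ^+ 2).

Lemma pure_shear_eigen (R : realType) (s m : R) (u : 'rV[R]_3) :
  s != 0 -> u *m pure_shear_stress s = m *: u -> shear_axis u.
Proof.
move=> s0 /rowP uT.
have := uT 0; have := uT 1; have := uT 2%:R.
rewrite !mxE !sum_ord3 !mxE /= !(mulr0, mulr1, addr0, add0r).
rewrite /shear_axis; move: (u 0 0) (u 0 1) (u 0 2%:R) => x y z mz my mx.
(* If [z = 0], then [s x^2 = m x y = s y^2]; otherwise the third equation forces [m = 0]. *)
have [z0|z0] := eqVneq z 0.
  right; split=> //; apply/(mulfI s0).
  have -> : s * x ^+ 2 = (x * s) * x by ring.
  have -> : s * y ^+ 2 = (y * s) * y by ring.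
  by rewrite my mx; ring.
have m0 : m = 0.
  by apply/eqP; move/esym/eqP: mz; rewrite mulf_eq0 (negPf z0) orbF.
by left; split; apply/(mulIf s0); rewrite ?my ?mx m0 !mul0r.
Qed.

(** * The shape of [B] forced by its eigenvectors *)

Definition row3 (R : Type) (x y z : R) : 'rV[R]_3 :=
  \row_i (if i == 0 then x else if i == 1 then y else z).

(** The cubic characteristic polynomial has a real root, hence an eigenvector [u] on some axis. If a
    required equality failed, a quadratic would yield an eigenvector orthogonal to [u] and off every
    axis. *)
Lemma shear_axis_form (R : realType) (B : 'M[R]_3) : B^T = B ->
  (forall (u : 'rV[R]_3) t, u != 0 -> u *m B = t *: u -> shear_axis u) ->
  [/\ B 0 0 = B 1 1, B 0 2%:R = 0 & B 1 2%:R = 0].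
Proof.
move=> BT axis.
have [t] : {t | root (char_poly B) t}.
  by apply: odd_poly_root; rewrite size_char_poly.
rewrite -eigenvalue_root_char => /eigenvalueP [u /rowP uB u0].
have uax : shear_axis u.
  by apply: (axis _ t) => //; apply/rowP.
have := uB 0; have := uB 1; have := uB 2%:R.
have B10 : B 1 0 = B 0 1 by rewrite -{1}BT mxE.
have B20 : B 2%:R 0 = B 0 2%:R by rewrite -{1}BT mxE.
have B21 : B 2%:R 1 = B 1 2%:R by rewrite -{1}BT mxE.
have axis3 x y z r : row3 x y z != 0 ->
    x * B 0 0 + y * B 0 1 + z * B 0 2%:R = r * x ->
    x * B 0 1 + y * B 1 1 + z * B 1 2%:R = r * y ->
    x * B 0 2%:R + y * B 1 2%:R + z * B 2%:R 2%:R = r * z ->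
    (x = 0 /\ y = 0) \/ (z = 0 /\ x ^+ 2 = y ^+ 2).
  move=> n0 e0 e1 e2; have := axis _ r n0; rewrite /shear_axis !mxE /=; apply.
  by apply: row3P; rewrite !mxE !sum_ord3 !mxE /= ?B10 ?B20 ?B21.
rewrite !mxE !sum_ord3 B10 B20 B21.
have u3 : ~ [/\ u 0 0 = 0, u 0 1 = 0 & u 0 2%:R = 0].
  by case=> x0 y0 z0; case/eqP: u0; apply: row3P; rewrite mxE.
case: uax.
  move=> [x0 y0]; move: u3; rewrite x0 y0 !mul0r !mulr0 !add0r.
  move=> u3 _ zb za.
  have z0 : u 0 2%:R != 0 by apply/eqP => z0; apply: u3.
  move/eqP: za; rewrite mulf_eq0 (negPf z0)/= => /eqP b02.
  move/eqP: zb; rewrite mulf_eq0 (negPf z0)/= => /eqP b12.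
  split=> //; apply/eqP; rewrite -subr_eq0; apply/contraT => d0.
  (* Here [u] spans the line of [e_3]. The quadratic says that [(e_1 + e_2) + w (e_1 - e_2)] is an
     eigenvector; it is on an axis only if [w = 0]. *)
  have [w w0 ew] := @quadratic_neq0_root _ _ (4 * B 0 1) 1 d0 ltr01.
  have n0 : row3 (1 + w) (1 - w) 0 != 0.
    by apply/eqP => /rowP w1; have := w1 0; have := w1 1; rewrite !mxE /=; lra.
  have [|||[]|[_]] := axis3 (1 + w) (1 - w) 0 ((B 0 0 + B 1 1 + 2 * B 0 1
      + w * (B 0 0 - B 1 1)) / 2) n0.
  - by lra.
  - by lra.
  - by rewrite b02 b12; ring.
  - by lra.
  - by move=> ww; case/eqP: w0; lra.
move=> [z0 xy]; rewrite z0 !mul0r !addr0 mulr0 => xyb y_eq x_eq.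
have x0 : u 0 0 != 0.
  apply/eqP => x0; apply: u3; split=> //.
  by move/eqP: xy; rewrite x0 expr0n eq_sym sqrf_eq0 => /eqP.
(* The sign [e] tells whether [u] is along [e_1 + e_2] or [e_1 - e_2]; the plane orthogonal to [u]
   is spanned by [(1, -e, 0)] and [e_3]. *)
have [e e1 ye] : exists2 e : R, e = 1 \/ e = - 1 & u 0 1 = e * u 0 0.
  move/eqP: xy; rewrite eqf_sqr => /orP[] /eqP ->.
    by exists 1; [left | rewrite mul1r].
  by exists (- 1); [right | rewrite mulN1r opprK].
have diagE : B 0 0 = B 1 1.
  apply: (mulfI x0); move: y_eq x_eq; rewrite ye.
  by case: e1 => ->; lra.
have b12 : B 1 2%:R = - e * B 0 2%:R.
  apply: (mulfI x0); move: xyb; rewrite ye.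
  by case: e1 => ->; lra.
suff b02 : B 0 2%:R = 0 by split=> //; rewrite b12 b02 mulr0.
apply/eqP; apply/contraT => b0.
(* The quadratic is the eigenvector condition for [(1, -e, w)]; its constant 2 is the squared length
   of [(1, -e, 0)]. *)
have [w w0 ew] := @quadratic_neq0_root _ _ (B 0 0 - e * B 0 1 - B 2%:R 2%:R) 2
  b0 (ltr0Sn _ 1).
have n0 : row3 1 (- e) w != 0.
  by apply/eqP => /rowP /(_ 0)/eqP; rewrite !mxE oner_eq0.
have [|||[]|[]] := axis3 1 (- e) w (B 0 0 - e * B 0 1 + w * B 0 2%:R) n0.
- by ring.
- by rewrite b12 -diagE; case: e1 => ->; ring.
- by rewrite b12; case: e1 ew => ->; lra.
- by lra.
- by move=> w00; rewrite w00 eqxx in w0.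
Qed.

(** * Singular values and the triangular factorisation *)

Lemma shear_form_stretch (R : realType) (F : 'M[R]_3) (p q r : R) :
  0 < \det F -> 0 < p + q -> 0 < p - q -> 0 < r ->
  F *m F^T = p *: (delta_mx 0 0 + delta_mx 1 1)
    + q *: (delta_mx 0 1 + delta_mx 1 0) + r *: delta_mx 2%:R 2%:R ->
  exists l1 l2 l3 : R,
    [/\ 0 < l1, 0 < l2, 0 < l3, singular_values F [:: l1; l2; l3] &
      let a := l1 * l2 * Num.sqrt (2 / (l1 ^+ 2 + l2 ^+ 2)) in
      let b := Num.sqrt ((l1 ^+ 2 + l2 ^+ 2) / 2) in
      let c := l3 in
      let g := (l1 ^+ 2 - l2 ^+ 2) / (l1 ^+ 2 + l2 ^+ 2) in
      exists Q : 'M[R]_3, special_orthogonal Q /\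
        F = simple_shear g *m diag3 a b c *m Q].
Proof.
move=> dF pq1 pq2 r0 FF.
have uF : F \in unitmx by rewrite unitmxE unitfE gt_eqF.
have sqrt_pos (x : R) : 0 < x -> exists2 l : R, 0 < l & l ^+ 2 = x.
  by move=> x0; exists (Num.sqrt x); rewrite ?sqrtr_gt0 ?sqr_sqrtr// ltW.
have [l1 l1_gt0 s1] := sqrt_pos _ pq1; have [l2 l2_gt0 s2] := sqrt_pos _ pq2.
have [l3 l3_gt0 s3] := sqrt_pos _ r0.
exists l1, l2, l3; split=> //.
  split; first by rewrite /= !ltW.
  (* [F] intertwines [F^T F] with [F F^T], whose eigenvalues are explicit. *)
  rewrite (@char_poly_conjugate _ _ F _ (F *m F^T)) ?mulmxA// FF.
  rewrite !big_cons big_nil s1 s2 s3 /char_poly det_mx33 !mxE /=.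
  rewrite !(mulr0, mulr1, addr0, add0r, mulr1n, mulr0n, sub0r, subr0).
  by rewrite !rmorphB !rmorphD /=; ring.
move=> a b c g; pose V := simple_shear g *m diag3 a b c.
have pp : 0 < p by lra.
have l12 : l1 ^+ 2 + l2 ^+ 2 = 2 * p by rewrite s1 s2; ring.
have gE : g = q / p by rewrite /g l12 s1 s2; field; rewrite gt_eqF.
have a2 : a ^+ 2 = (p ^+ 2 - q ^+ 2) / p.
  rewrite /a l12 !exprMn sqr_sqrtr ?divr_ge0 ?mulr_ge0 ?(ltW pp)// s1 s2.
  by field; rewrite gt_eqF.
have b2 : b ^+ 2 = p.
  rewrite /b l12 sqr_sqrtr ?divr_ge0 ?mulr_ge0 ?(ltW pp)//; first by field.
have a0 : 0 < a.
  by rewrite /a l12 !mulr_gt0 ?sqrtr_gt0// ?divr_gt0 ?mulr_gt0.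
have b0 : 0 < b by rewrite /b sqrtr_gt0 l12 divr_gt0// mulr_gt0.
have VV : V *m V^T = F *m F^T.
  rewrite FF; apply: matrix3P;
  rewrite !mxE !sum_ord3 !mxE !sum_ord3 !mxE /=;
  rewrite !(mulr0, mulr1, addr0, add0r, mulr1n, mulr0n, mul0r, mul1r).
  - transitivity (a ^+ 2 + g ^+ 2 * b ^+ 2); first by ring.
    by rewrite a2 b2 gE; field; rewrite gt_eqF.
  - transitivity (g * b ^+ 2); first by ring.
    by rewrite b2 gE divfK// gt_eqF.
  - by [].
  - transitivity (g * b ^+ 2); first by ring.
    by rewrite b2 gE divfK// gt_eqF.
  - by rewrite -b2 expr2.
  - by [].
  - by [].
  - by [].
  - by rewrite -s3 expr2.
(* [V V^T = F F^T] fixes the determinant up to sign; both are positive. *)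
have detV : \det V = \det F.
  have : \det V ^+ 2 = \det F ^+ 2.
    by rewrite !expr2 -[X in _ * X = _]det_tr -det_mulmx VV det_mulmx det_tr.
  move/eqP; rewrite eqf_sqr => /orP[/eqP//|/eqP dN].
  suff : 0 < \det V by rewrite dN oppr_gt0 => /(lt_trans dF); rewrite ltxx.
  rewrite det_mulmx !det_mx33 !mxE /=.
  rewrite !(mulr0, mulr1, addr0, add0r, mulr1n, mulr0n, mul0r, mul1r, subr0).
  by apply: mulr_gt0 => //; apply: mulr_gt0.
have uV : V \in unitmx by rewrite unitmxE detV -unitmxE.
exists (invmx V *m F); split; last by rewrite mulKVmx.
split; last by rewrite det_mulmx det_inv detV mulVf// gt_eqF.
by rewrite trmx_mul -mulmxA (mulmxA F) -VV trmx_inv -mulmxA mulmxV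
  ?unitmx_tr// mulmx1 mulVmx.
Qed.

Unset Implicit Arguments.
Set Strict Implicit.

Theorem corollary2p9 (R : realType) (sigma : 'M[R]_3 -> 'M[R]_3)
    (sigma_iso : isotropic_stress_response sigma)
    (sigma_ref : unique_stress_free_reference sigma)
    (F : 'M[R]_3) (detF_gt0 : 0 < \det F)
    (F_shear : exists s : R, sigma (F *m F^T) = pure_shear_stress s) :
  exists l1 l2 l3 : R,
    [/\ 0 < l1, 0 < l2, 0 < l3, singular_values F [:: l1; l2; l3] &
      let a := l1 * l2 * Num.sqrt (2 / (l1 ^+ 2 + l2 ^+ 2)) in
      let b := Num.sqrt ((l1 ^+ 2 + l2 ^+ 2) / 2) in
      let c := l3 in
      let g := (l1 ^+ 2 - l2 ^+ 2) / (l1 ^+ 2 + l2 ^+ 2) in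
      exists Q : 'M[R]_3, special_orthogonal Q /\
        F = simple_shear g *m diag3 a b c *m Q].
Proof.
have uF : F \in unitmx by rewrite unitmxE unitfE gt_eqF.
have pB := pos_def_mulmx_tr uF; move EB : (F *m F^T) pB F_shear => B pB F_shear.
have BT : B^T = B by apply/symmetricmxP; case: pB.
have [B0011 B02 B12] : [/\ B 0 0 = B 1 1, B 0 2%:R = 0 & B 1 2%:R = 0].
  case: F_shear => s sB; have [s0|s0] := eqVneq s 0.
    have -> : B = 1%:M.
      by apply/(sigma_ref _ pB); rewrite sB s0 /pure_shear_stress scale0r.
    by rewrite !mxE.
  apply: shear_axis_form => // u t u_neq0 uB.
  have [m um] := eigen_stress sigma_iso pB u_neq0 uB.
  by apply: (pure_shear_eigen s0); rewrite -sB um.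
have BE : B = B 0 0 *: (delta_mx 0 0 + delta_mx 1 1)
    + B 0 1 *: (delta_mx 0 1 + delta_mx 1 0)
    + B 2%:R 2%:R *: delta_mx 2%:R 2%:R.
  have B10 : B 1 0 = B 0 1 by rewrite -{1}BT mxE.
  have B20 : B 2%:R 0 = 0 by rewrite -BT mxE.
  have B21 : B 2%:R 1 = 0 by rewrite -BT mxE.
  apply: matrix3P; rewrite !mxE /= ?B10 ?B20 ?B21 ?B02 ?B12 -?B0011.
  all: rewrite ?(mulr0, mulr1, addr0, add0r) //.
(* Evaluated at [(1, 1, 0)], [(1, -1, 0)] and [e_3], this form gives twice [p + q], twice [p - q],
   and [r]. *)
have posB x y z : row3 x y z != 0 ->
    0 < x ^+ 2 * B 0 0 + 2 * (x * y) * B 0 1 + y ^+ 2 * B 0 0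
        + z ^+ 2 * B 2%:R 2%:R.
  move=> n0; have := pB.2 (row3 x y z)^T; rewrite trmx_eq0 trmxK => /(_ n0).
  rewrite BE !mxE !sum_ord3 !mxE !sum_ord3 !mxE /=; congr (0 < _); ring.
apply: (@shear_form_stretch _ _ (B 0 0) (B 0 1) (B 2%:R 2%:R)); rewrite ?EB//.
- have := posB 1 1 0; rewrite (_ : row3 _ _ _ != 0); first by lra.
  by apply/eqP => /rowP /(_ 0)/eqP; rewrite !mxE oner_eq0.
- have := posB 1 (- 1) 0; rewrite (_ : row3 _ _ _ != 0); first by lra.
  by apply/eqP => /rowP /(_ 0)/eqP; rewrite !mxE oner_eq0.
- have := posB 0 0 1; rewrite (_ : row3 _ _ _ != 0); first by lra.
  by apply/eqP => /rowP /(_ 2%:R)/eqP; rewrite !mxE oner_eq0.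
Qed.
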